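(* Let $p$ be a prime, $n\ge1$ and $s>0$. Consider the following problem for a function $P$ on the vertices of $\mathcal{T}_{p^n}$ with integrable layers $P_k$: \[\begin{cases}\Delta_wP(v)=0,& v\in\mathcal{T}_{p^n};\\ P_k(\boldsymbol{y})\,d\boldsymbol{y}\rightharpoonup\delta_{\boldsymbol{0}},& k\to+\infty;\\ \int_{\mathbb{Q}_p^n}P_k(\boldsymbol{y})\,d\boldsymbol{y}=1,& k\in\mathbb{Z};\\ \|P_k\|_\infty\to0,& k\to-\infty,\end{cases}\] where $\rightharpoonup$ denotes weak-$*$ convergence of finite Radon measures tested against functions in $C_0(\mathbb{Q}_p^n)$. The solution of this problem (the Poisson kernel) is given, for $k\in\mathbb{Z}$ and $\boldsymbol{y}\in\mathbb{Q}_p^n$, by \[P_k(\boldsymbol{y})=\frac{1-p^{-s}}{1-p^{-(s+n)}}\begin{cases}p^{nk},& v_p(\boldsymbol{y})\ge k;\\ p^{-sk}\|\boldsymbol{y}\|_p^{-s-n},& v_p(\boldsymbol{y})<k.\end{cases}\]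
   Context: For $\boldsymbol{x}\in\mathbb{Q}_p^n$: $\|\boldsymbol{x}\|_p=\max_i|x_i|_p$, $v_p(\boldsymbol{x})=\min_iv_p(x_i)$, $v_p(\boldsymbol{0})=+\infty$. $d\boldsymbol{y}$ is Haar measure with $|\mathbb{Z}_p^n|=1$. Tree: the vertices of $\mathcal{T}_{p^n}$ are the pairs $(\boldsymbol{x},k)$ with $k\in\mathbb{Z}$ and $\boldsymbol{x}\in\mathbb{Q}_p^n/p^k\mathbb{Z}_p^n$. Each $(\boldsymbol{x},k)$ is adjacent to its unique upper neighbor $(\boldsymbol{x},k-1)$ and to its $p^n$ lower neighbors $(\boldsymbol{x}+\boldsymbol{a}p^k,k+1)$, $\boldsymbol{a}\in\mathbb{F}_p^n$ (identified with $\{0,\dots,p-1\}^n$), and to no other vertex. For a function $P$ on vertices, $P_k(\boldsymbol{y})=P(\boldsymbol{y},k)$, regarded as a function on $\mathbb{Q}_p^n$ constant on cosets of $p^k\mathbb{Z}_p^n$. The edge joining $(\boldsymbol{x},k-1)$ and $(\boldsymbol{x},k)$ has weight $w=p^{k(s-n)}$, and $\Delta_wP(v)=\sum_{u\sim v}w_{uv}(P(u)-P(v))$. *)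

(* Defs.v *)
From HB Require Import structures.
From mathcomp Require Import all_boot all_order all_algebra.
From mathcomp Require Import generic_quotient fraction.
From mathcomp Require Import all_classical all_reals all_analysis.

Set Implicit Arguments.
Unset Strict Implicit.
Unset Printing Implicit Defensive.

Import Order.TTheory GRing.Theory Num.Theory.
Import numFieldNormedType.Exports.

Local Open Scope classical_set_scope.
Local Open Scope ring_scope.

(* Z_p as the inverse limit of the Z/p^k: [residue k] is the representative
   in {0, ..., p^k - 1} of the class modulo p^k; the compatibility equation
   also forces [residue k] to be reduced. The primality proof is a phantom
   parameter on which instances are keyed. *)
Record padic_int (p : nat) (p_pr : prime p) := PadicInt {
  residue :> nat -> int;
  residueP : forall k, residue k = (residue k.+1 %% (p ^ k)%N)%Z
}.

Section PadicInt.
Variables (p : nat) (p_pr : prime p).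
Local Notation Zp := (padic_int p_pr).
Local Notation "m %%^ k" := (modz m (Posz (p ^ k)%N)) (at level 40).
Implicit Types a b c : Zp.

Lemma padic_int_eqP a b : a =1 b -> a = b.
Proof.
case: a b => [f fP] [g gP] /= /funext fg.
by case: _ / fg gP => gP; congr PadicInt; exact: Prop_irrelevance.
Qed.

HB.instance Definition _ := gen_eqMixin Zp.
HB.instance Definition _ := gen_choiceMixin Zp.

Let modz_exp (m : int) i j : (i <= j)%N -> (m %%^ j) %%^ i = m %%^ i.
Proof.
move=> ij; rewrite [in RHS](divz_eq m (p ^ j)%N) -{3}(subnK ij) expnD PoszM.
by rewrite mulrA modzMDl.
Qed.

Lemma residue_id a i : a i %%^ i = a i.
Proof. by rewrite (residueP a) modz_exp. Qed.

Lemma residue_mod a i j : (i <= j)%N -> a i = a j %%^ i.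
Proof.
elim: j => [|j IHj]; first by rewrite leqn0 => /eqP ->; rewrite residue_id.
rewrite leq_eqVlt => /predU1P[->|]; first by rewrite residue_id.
by rewrite ltnS => ij; rewrite (IHj ij) (residueP a) modz_exp.
Qed.

Fact of_int_subproof (m : int) k : m %%^ k = (m %%^ k.+1) %%^ k.
Proof. by rewrite modz_exp. Qed.
Definition padic_of_int (m : int) : Zp := PadicInt p_pr (of_int_subproof m).

Fact add_subproof a b k : (a k + b k) %%^ k = ((a k.+1 + b k.+1) %%^ k.+1) %%^ k.
Proof. by rewrite modz_exp // (residueP a) (residueP b) modzDm. Qed.
Definition padic_add a b : Zp := PadicInt p_pr (add_subproof a b).

Fact opp_subproof a k : (- a k) %%^ k = ((- a k.+1) %%^ k.+1) %%^ k.
Proof. by rewrite modz_exp // (residueP a) modzNm. Qed.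
Definition padic_opp a : Zp := PadicInt p_pr (opp_subproof a).

Fact mul_subproof a b k : (a k * b k) %%^ k = ((a k.+1 * b k.+1) %%^ k.+1) %%^ k.
Proof. by rewrite modz_exp // (residueP a) (residueP b) modzMm. Qed.
Definition padic_mul a b : Zp := PadicInt p_pr (mul_subproof a b).

Fact padic_addA : associative padic_add.
Proof.
by move=> a b c; apply: padic_int_eqP => k /=; rewrite modzDmr modzDml addrA.
Qed.

Fact padic_addC : commutative padic_add.
Proof. by move=> a b; apply: padic_int_eqP => k /=; rewrite addrC. Qed.

Fact padic_add0 : left_id (padic_of_int 0) padic_add.
Proof.
by move=> a; apply: padic_int_eqP => k /=; rewrite modzDml add0r residue_id.
Qed.

Fact padic_addN : left_inverse (padic_of_int 0) padic_opp padic_add.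
Proof.
by move=> a; apply: padic_int_eqP => k /=; rewrite modzDml addNr.
Qed.

HB.instance Definition _ :=
  GRing.isZmodule.Build Zp padic_addA padic_addC padic_add0 padic_addN.

Fact padic_mulA : associative padic_mul.
Proof.
by move=> a b c; apply: padic_int_eqP => k /=; rewrite modzMmr modzMml mulrA.
Qed.

Fact padic_mulC : commutative padic_mul.
Proof. by move=> a b; apply: padic_int_eqP => k /=; rewrite mulrC. Qed.

Fact padic_mul1 : left_id (padic_of_int 1) padic_mul.
Proof.
by move=> a; apply: padic_int_eqP => k /=; rewrite modzMml mul1r residue_id.
Qed.

Fact padic_mulDl : left_distributive padic_mul padic_add.
Proof.
by move=> a b c; apply: padic_int_eqP => k /=; rewrite modzMml modzDm mulrDl.
Qed.

Fact padic_1neq0 : padic_of_int 1 != padic_of_int 0.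
Proof.
apply/eqP => /(congr1 (fun a : Zp => a 1%N)) /=.
by rewrite expn1 mod0z modz_small //= ltz_nat prime_gt1.
Qed.

HB.instance Definition _ := GRing.Zmodule_isComNzRing.Build Zp
  padic_mulA padic_mulC padic_mul1 padic_mulDl padic_1neq0.

Lemma residueD a b k : (a + b) k = (a k + b k) %%^ k. Proof. by []. Qed.
Lemma residueN a k : (- a) k = (- a k) %%^ k. Proof. by []. Qed.
Lemma residueM a b k : (a * b) k = (a k * b k) %%^ k. Proof. by []. Qed.
Lemma residue0 k : (0 : Zp) k = 0. Proof. by rewrite [LHS]mod0z. Qed.
Lemma residue1 k : (1 : Zp) k = 1 %%^ k. Proof. by []. Qed.

Lemma residue_nat m k : (m%:R : Zp) k = m%:Z %%^ k.
Proof.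
elim: m => [|m IHm]; first by rewrite residue0 mod0z.
by rewrite mulrS residueD IHm residue1 modzDm.
Qed.

Let p_gt0 i : (0 < p ^ i)%N. Proof. by rewrite expn_gt0 prime_gt0. Qed.
Let p_neq0 i : ((p ^ i)%N : int) != 0. Proof. by rewrite eqz_nat -lt0n. Qed.

Lemma padic_int_unit a : a 1%N != 0 -> exists b, b * a = 1.
Proof.
move=> a1; have cop k : coprimez (a k) (p ^ k)%N.
  case: k => [|k]; first by rewrite expn0 coprimezE coprimen1.
  rewrite coprimezE /= coprime_sym coprimeXl // prime_coprime //.
  apply: contra a1 => pa; rewrite (residue_mod a (ltn0Sn k)) expn1.
  by apply/eqP/dvdz_mod0P; rewrite dvdzE.
pose b k := (egcdz (a k) (p ^ k)%N).1 %%^ k.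
have abk k : (b k * a k) %%^ k = 1 %%^ k.
  rewrite /b modzMml; have := cop k; rewrite /coprimez => /eqP g1.
  case: egcdzP => u v /= uv _; rewrite -{1}g1 in uv *.
  by rewrite -uv addrC modzMDl.
have bP k : b k = b k.+1 %%^ k.
  have e1 : b k.+1 * a k.+1 = 1 %[mod (p ^ k)%N]%Z.
    by rewrite -(modz_exp _ (leqnSn k)) abk modz_exp.
  have -> : b k = (b k * (b k.+1 * a k.+1)) %%^ k.
    by rewrite -modzMmr e1 modzMmr mulr1 /b modz_mod.
  rewrite mulrCA -modzMmr -[X in _ * X]modzMmr -residueP.
  by rewrite abk modzMmr mulr1.
by exists (PadicInt p_pr bP); apply: padic_int_eqP => k; rewrite residueM /= abk.
Qed.

Definition padic_unit : pred Zp := fun a => `[< exists b, b * a = 1 >].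

Definition padic_inv a : Zp :=
  if pselect (exists b, b * a = 1) is left h then projT1 (cid h) else a.

Fact padic_mulVr : {in padic_unit, left_inverse 1 padic_inv *%R}.
Proof.
move=> a; rewrite unfold_in => /asboolP h; rewrite /padic_inv.
by case: pselect => // h'; exact: (projT2 (cid h')).
Qed.

Fact padic_unitPl a b : b * a = 1 -> padic_unit a.
Proof. by move=> ba; apply/asboolP; exists b. Qed.

Fact padic_inv_out : {in [predC padic_unit], padic_inv =1 id}.
Proof.
move=> a; rewrite inE unfold_in => /asboolP h; rewrite /padic_inv.
by case: pselect.
Qed.

HB.instance Definition _ := GRing.ComNzRing_hasMulInverse.Build Zp
  padic_mulVr padic_unitPl padic_inv_out.

Lemma padic_int_unitP a : a 1%N != 0 -> a \is a GRing.unit.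
Proof. by move=> /padic_int_unit h; apply/asboolP. Qed.

Lemma padic_int_dvdp a i : a i = 0 -> exists b, a = p%:R ^+ i * b.
Proof.
move=> ai; have pa k : ((p ^ i)%N %| a (k + i)%N)%Z.
  by apply/dvdz_mod0P; rewrite -(residue_mod a (leq_addl k i)).
pose b k := (a (k + i)%N %/ (p ^ i)%N)%Z.
have bP k : b k = b k.+1 %%^ k.
  apply: (mulIf (p_neq0 i)); rewrite /b divzK //.
  rewrite (residue_mod a (leq_addr 1 (k + i))) addn1.
  rewrite -[in LHS](divzK (pa k.+1)) addSn expnD PoszM.
  by rewrite -mulz_modl ?divzK // ?ltz_nat //.
exists (PadicInt p_pr bP); apply: padic_int_eqP => k.
rewrite -natrX residueM residue_nat modzMml /= /b mulrC divzK //.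
by rewrite -residue_mod // leq_addr.
Qed.

Lemma padic_int_mulpI a i : p%:R ^+ i * a = 0 -> a = 0.
Proof.
elim: i => [|i IHi]; first by rewrite mul1r.
rewrite exprS -mulrA => pa; apply: IHi; move: (_ * a) pa => {}a pa.
apply: padic_int_eqP => k; rewrite residue0 (residueP a).
have /(congr1 (fun a : Zp => a k.+1)) := pa.
rewrite residueM residue_nat residue0 modzMml => /dvdz_mod0P.
rewrite expnS PoszM dvdz_mul2l; last by rewrite eqz_nat -lt0n prime_gt0.
by move/dvdz_mod0P.
Qed.

Lemma padic_int_split a : a != 0 ->
  exists i u, u \is a GRing.unit /\ a = p%:R ^+ i * u.
Proof.
move=> a0; have [k ak] : exists k, a k != 0.
  apply: contra_neqP a0 => h; apply: padic_int_eqP => k.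
  by rewrite residue0; apply/eqP; apply: contra_notT h => ?; exists k.
have a00 : a 0%N = 0 by rewrite residueP expn0 modz1.
case: (ex_minnP (ex_intro (fun k => a k != 0) _ ak)) => -[|i].
  by rewrite a00 eqxx.
move=> ai mi; have ai0 : a i = 0.
  by apply/eqP; apply: contraT => /mi; rewrite ltnn.
have [u au] := padic_int_dvdp ai0; exists i, u; split=> //.
apply: padic_int_unitP; apply: contra ai => /eqP /padic_int_dvdp[w uw].
rewrite au uw expr1 mulrA -exprSr -natrX residueM residue_nat modzz.
by rewrite mul0r mod0z.
Qed.

Fact padic_int_integral : GRing.integral_domain_axiom Zp.
Proof.
move=> a b ab; apply/orP; have [_|a0] := eqVneq a 0; first by left.
right; have [i [u [uu au]]] := padic_int_split a0.
move: ab; rewrite au -mulrA => /padic_int_mulpI ub.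
by rewrite -(mulKr uu b) ub mulr0.
Qed.

HB.instance Definition _ :=
  GRing.ComUnitRing_isIntegral.Build Zp padic_int_integral.

End PadicInt.

Definition padic (p : nat) (p_pr : prime p) := {fraction padic_int p_pr}.

Section Padic.
Variables (p : nat) (p_pr : prime p).
Local Notation Zp := (padic_int p_pr).
Local Notation Qp := (padic p_pr).
Implicit Types x y z : Qp.

HB.instance Definition _ := GRing.Field.on Qp.
HB.instance Definition _ := isPointed.Build Qp 0.

Definition padic_embed : Zp -> Qp := @FracField.tofrac Zp.
HB.instance Definition _ := GRing.RMorphism.on padic_embed.

Definition padic_ideal (k : int) : set Qp :=
  [set (p%:R : Qp) ^ k * padic_embed a | a in [set: Zp]].

(* By [padic_ideal_split] the default value of [xget] is never used. *)
Definition padic_val x : \bar int :=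
  if x == 0 then +oo%E
  else (xget 0 [set k | padic_ideal k x /\ ~ padic_ideal (k + 1) x])%:E.

Definition padic_norm x : rat :=
  if padic_val x is k%:E then (p%:R : rat) ^ (- k) else 0.

Lemma padic_embed_inj : injective padic_embed.
Proof. by move=> a b /eqP; rewrite tofrac_eq => /eqP. Qed.

Lemma padic_p_neq0 : (p%:R : Qp) != 0.
Proof.
rewrite -(rmorph_nat padic_embed) -(rmorph0 padic_embed).
rewrite (inj_eq padic_embed_inj); apply/eqP => p0.
have := @padic_int_mulpI _ p_pr 1 1; rewrite expr1 mulr1 p0 => /(_ erefl).
exact/eqP/oner_neq0.
Qed.

Lemma padic_frac x : exists a b : Zp, b != 0 /\ x = padic_embed a / padic_embed b.
Proof.
elim/quotW: x => -[[a b] /= b0]; exists a, b; split=> //.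
have eb0 : padic_embed b != 0 by rewrite /padic_embed tofrac_eq0.
apply: (mulIf eb0); rewrite divfK //.
rewrite /padic_embed; unlock FracField.tofrac; rewrite -[LHS]FracField.pi_mul.
apply/eqmodP => /=; rewrite /FracField.equivf /FracField.mulf /=.
by rewrite !numden_Ratio ?(oner_neq0, mulr1, mul1r) // mulrC.
Qed.

Lemma padic_ideal0 k : padic_ideal k 0.
Proof. by exists 0; rewrite // rmorph0 mulr0. Qed.

Lemma padic_idealB k x y :
  padic_ideal k x -> padic_ideal k y -> padic_ideal k (x - y).
Proof. by move=> [a _ <-] [b _ <-]; exists (a - b); rewrite // rmorphB mulrBr. Qed.

Lemma padic_idealN k x : padic_ideal k (- x) <-> padic_ideal k x.
Proof.
have h z : padic_ideal k z -> padic_ideal k (- z).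
  by rewrite -[- z]add0r; apply: padic_idealB; exact: padic_ideal0.
by split=> /h; rewrite ?opprK.
Qed.

Lemma padic_idealD k x y :
  padic_ideal k x -> padic_ideal k y -> padic_ideal k (x + y).
Proof.
by move=> kx /padic_idealN ky; rewrite -[y]opprK; exact: padic_idealB.
Qed.

Lemma padic_ideal_le i j : i <= j -> padic_ideal j `<=` padic_ideal i.
Proof.
rewrite -subr_ge0 => ij x [a _ <-].
exists (p%:R ^+ `|j - i|%N * a) => //.
rewrite rmorphM rmorphXn rmorph_nat mulrA; congr (_ * _).
rewrite -[X in _ * X]/(p%:R ^ (`|j - i|%N : int)) gez0_abs //.
by rewrite -expfzDr ?padic_p_neq0 // addrCA subrr addr0.
Qed.

Lemma padic_ideal_split x : x != 0 ->
  exists k, padic_ideal k x /\ ~ padic_ideal (k + 1) x.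
Proof.
move=> x0; have [a [b [b0 xab]]] := padic_frac x.
have a0 : a != 0 by apply: contraNneq x0 => a0; rewrite xab a0 rmorph0 mul0r.
have [i [u [uu au]]] := padic_int_split a0.
have [j [v [vu bv]]] := padic_int_split b0.
have ev0 : padic_embed v != 0.
  by apply: contraTneq vu; rewrite -(rmorph0 padic_embed) => /padic_embed_inj ->;
    rewrite unitr0.
have pn0 m : (p%:R : Qp) ^ (m : int) != 0 by rewrite expfz_neq0 ?padic_p_neq0.
have xE : x = p%:R ^ (i%:Z - j%:Z) * padic_embed (u / v).
  rewrite xab au bv !rmorphM !rmorphXn !rmorph_nat rmorphV //.
  rewrite invfM expfzDr ?padic_p_neq0 // -invr_expz.
  by rewrite -!mulrA; congr (_ * _); rewrite mulrCA.
exists (i%:Z - j%:Z); split; first by exists (u / v).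
move=> [c _]; rewrite xE expfzDr ?padic_p_neq0 // expr1z -mulrA.
move=> /(mulfI (pn0 _)); rewrite -(rmorph_nat padic_embed) -rmorphM.
move=> /padic_embed_inj pc.
have : (p%:R * c) * (v / u) = 1.
  by rewrite pc mulrA mulrVK // mulrV.
move=> /(congr1 (fun a : Zp => a 1%N)).
rewrite residueM residueM residue_nat expn1 modzz mul0r mod0z mul0r mod0z.
by rewrite residue1 expn1 modz_small //= ltz_nat prime_gt1.
Qed.

Lemma padic_val_ge k x : (k%:E <= padic_val x)%E <-> padic_ideal k x.
Proof.
rewrite /padic_val; have [->|x0] := eqVneq x 0.
  by split=> _; [exact: padic_ideal0|exact: leey].
have [mx mNx] := xgetPex 0 (padic_ideal_split x0).
set m := xget _ _ in mx mNx *; rewrite lee_fin; split.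
  by move=> /padic_ideal_le; apply.
by move=> kx; rewrite leNgt; apply/negP; rewrite -lezD1 => /padic_ideal_le /(_ _ kx).
Qed.

Lemma padic_norm_ge0 x : 0 <= padic_norm x.
Proof. by rewrite /padic_norm; case: padic_val => // k; rewrite exprz_ge0. Qed.

Lemma padic_norm_le k x : padic_norm x <= p%:R ^ (- k) <-> padic_ideal k x.
Proof.
have p1 : (1 : rat) < p%:R by rewrite ltr1n prime_gt1.
rewrite -padic_val_ge /padic_norm /padic_val; case: eqP => _.
  by rewrite exprz_ge0 // leey.
by rewrite lee_fin ler_eXz2l // lerN2.
Qed.

Lemma padic_norm0 : padic_norm 0 = 0.
Proof. by rewrite /padic_norm /padic_val eqxx. Qed.

Lemma padic_norm_eq0 x : padic_norm x = 0 -> x = 0.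
Proof.
rewrite /padic_norm /padic_val; case: eqP => // _ /eqP.
by rewrite expfz_eq0 pnatr_eq0 eqn0Ngt prime_gt0 // andbF.
Qed.

Lemma padic_normN x : padic_norm (- x) = padic_norm x.
Proof.
suff vN : padic_val (- x) = padic_val x by rewrite /padic_norm vN.
rewrite /padic_val oppr_eq0; case: eqP => // _; congr ((xget _ _)%:E).
by apply/seteqP; split=> k /=; rewrite !padic_idealN.
Qed.

Lemma padic_normD x y : padic_norm (x + y) <= Num.max (padic_norm x) (padic_norm y).
Proof.
have normE z : z != 0 -> exists k, padic_norm z = p%:R ^ (- k).
  by rewrite /padic_norm /padic_val => /negbTE ->; eexists.
wlog xy : x y / padic_norm x <= padic_norm y.
  move=> h; case/orP: (le_total (padic_norm x) (padic_norm y)) => [/h //|/h].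
  by rewrite addrC maxC.
rewrite max_r //; have [y0|/normE[k yk]] := eqVneq y 0.
  by rewrite y0 addr0 -y0.
move: xy; rewrite yk => /padic_norm_le kx; apply/padic_norm_le.
by apply: padic_idealD => //; apply/padic_norm_le; rewrite yk.
Qed.

Definition padic_dist x y : rat := padic_norm (x - y).

Fact padic_distxx x : padic_dist x x = 0.
Proof. by rewrite /padic_dist subrr padic_norm0. Qed.

Fact padic_dist_positivity x y : padic_dist x y = 0 -> x = y.
Proof. by move=> /padic_norm_eq0 /eqP; rewrite subr_eq0 => /eqP. Qed.

Fact padic_dist_sym x y : padic_dist x y = padic_dist y x.
Proof. by rewrite /padic_dist -padic_normN opprB. Qed.

Fact padic_dist_triangle y x z :
  padic_dist x z <= padic_dist x y + padic_dist y z.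
Proof.
rewrite /padic_dist -(subrKA y); apply: le_trans (padic_normD _ _) _.
by rewrite ge_max lerDl lerDr !padic_norm_ge0.
Qed.

HB.instance Definition _ := isMetric.Build rat Qp
  padic_distxx padic_dist_positivity padic_dist_sym padic_dist_triangle.

End Padic.

Section PadicSpace.
Variables (p : nat) (p_pr : prime p) (n : nat).
Local Notation Qp := (padic p_pr).
Local Notation Qpn := 'rV[Qp]_n.
Implicit Types x y : Qpn.

Definition vec_val x : \bar int := \big[Order.min/+oo%E]_(i < n) padic_val (x 0 i).

Definition vec_norm x : rat := \big[Num.max/0]_(i < n) padic_norm (x 0 i).

Definition lattice (k : int) : set Qpn :=
  [set (p%:R : Qp) ^ k *: map_mx (@padic_embed p p_pr) a
     | a in [set: 'rV[padic_int p_pr]_n]].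

Definition padic_space := g_sigma_algebraType [set U : set Qpn | open U].
HB.instance Definition _ := Measurable.on padic_space.

Variable R : realType.
Implicit Types mu nu : {measure set padic_space -> \bar R}.

Definition haar_measure mu :=
  (forall x (A : set padic_space), measurable A ->
     mu [set x + y | y in A] = mu A) /\
  mu (lattice 0) = 1%E.

Definition C0 (f : Qpn -> R) :=
  continuous f /\
  forall e, 0 < e -> exists2 K, compact K & forall x, ~ K x -> `|f x| < e.

(* weak-* convergence of the signed measures g_m(y) dmu(y) to nu *)
Definition weakstar_cvg mu (g : nat -> Qpn -> R) nu :=
  forall f : Qpn -> R, C0 f ->
    (\int[mu]_y (g m y * f y)%:E @[m --> \oo] --> \int[nu]_y (f y)%:E)%E.

End PadicSpace.

Section Tree.
Variables (p : nat) (p_pr : prime p) (n : nat).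
Local Notation Qp := (padic p_pr).
Local Notation Qpn := 'rV[Qp]_n.

Definition coset (k : int) (x : Qpn) : set Qpn :=
  [set y | lattice k (y - x)].

Record vertex := Vertex {
  level : int;
  cell : set Qpn;
  cellP : exists x, cell = coset level x
}.

HB.instance Definition _ := gen_eqMixin vertex.
HB.instance Definition _ := gen_choiceMixin vertex.

Definition vtx (x : Qpn) (k : int) : vertex :=
  @Vertex k (coset k x) (ex_intro _ x erefl).

Definition digits (a : 'rV['I_p]_n) : Qpn :=
  map_mx (fun d : 'I_p => (d : nat)%:R) a.

Definition upper_neighbor (v u : vertex) :=
  exists x k, v = vtx x k /\ u = vtx x (k - 1).

Definition lower_neighbor (v u : vertex) :=
  exists x k a, v = vtx x k /\
    u = vtx (x + (p%:R : Qp) ^ k *: digits a) (k + 1).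

Definition neighbors (v : vertex) : set vertex :=
  [set u | upper_neighbor v u \/ lower_neighbor v u].

Variables (R : realType) (s : R).

(* the weight depends on the level of the lower endpoint of the edge *)
Definition weight (u v : vertex) : R :=
  p%:R `^ ((Num.max (level u) (level v))%:~R * (s - n%:R)).

(* The set [neighbors v] is finite (p^n + 1 elements), so that the finitely
   supported sum is the actual sum over neighbors. *)
Definition laplacian (P : vertex -> R) (v : vertex) : R :=
  \sum_(u \in neighbors v) weight u v * (P u - P v).

Definition layer (P : vertex -> R) (k : int) (y : Qpn) : R := P (vtx y k).

Definition poisson_kernel (k : int) (y : Qpn) : R :=
  (1 - p%:R `^ (- s)) / (1 - p%:R `^ (- (s + n%:R))) *
  (if (k%:E <= vec_val y)%E then p%:R `^ (n%:R * k%:~R)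
   else p%:R `^ (- s * k%:~R) * (ratr (vec_norm y)) `^ (- s - n%:R)).

Variable mu : {measure set (padic_space p_pr n) -> \bar R}.

(* Limits as the integer level tends to +oo or -oo are taken along m and -m,
   for m a natural number. *)
Record poisson_problem (P : vertex -> R) : Prop := PoissonProblem {
  layer_integrable : forall k, mu.-integrable setT (EFin \o layer P k);
  harmonic : forall v, laplacian P v = 0;
  initial_layer : weakstar_cvg mu (fun m : nat => layer P m)
    (\d_((0 : Qpn) : padic_space p_pr n));
  total_mass : forall k, (\int[mu]_y (layer P k y)%:E = 1)%E;
  decay : ('N[mu]_+oo%E [EFin \o layer P (- m%:Z)] @[m --> \oo] --> 0)%E
}.

End Tree.

(* Main.v *)
Require Import Defs.
From HB Require Import structures.
From mathcomp Require Import all_boot all_order all_algebra.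
From mathcomp Require Import all_classical all_reals all_analysis.
From mathcomp Require Import measurable_realfun ess_sup_inf.
From mathcomp Require Import zify ring.
Import Order.TTheory GRing.Theory Num.Theory.
Import numFieldNormedType.Exports.
Local Open Scope classical_set_scope.
Local Open Scope ring_scope.

Set Implicit Arguments.
Unset Strict Implicit.
Unset Printing Implicit Defensive.

(* Put r = p^(-s) and q = p^n. If P is harmonic, the averages A_m of its layers
   k + m over a fixed cell (x, k) satisfy A_(m+1) - A_m = r (A_m - A_(m-1)),
   with A_(-1) = P(x, k-1), so they converge to
   (P(x, k) - r P(x, k-1)) / (1 - r). The weak-* condition, tested against the
   indicator of the compact open cell, forces this limit to be q^k if 0 lies in
   the cell and 0 otherwise. Hence every solution satisfies the recursion
     P(x, k) = r P(x, k-1) + (1 - r) q^k [0 in the cell (x, k)],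
   which conversely implies harmonicity. The difference D of two solutions
   satisfies D(x, k) = r^m D(x, k-m), and the decay as k -> -oo gives D = 0. The
   kernel satisfies the recursion by inspection, and the formula for the A_m
   over the balls centered at 0 also yields its total mass. *)

Lemma setT_index_enum (T : finType) : [set: T] = [set` index_enum T].
Proof. by apply/seteqP; split=> // a _; exact: mem_index_enum. Qed.

(** * Lattices, their cosets, and the subdivision of a coset into children *)

Section Lattice.
Variables (p : nat) (p_pr : prime p).
Local Notation Zp := (padic_int p_pr).
Local Notation Qp := (padic p_pr).
Implicit Types (k j : int) (t : Qp).

Lemma padic_ideal_shift k j t :
  padic_ideal (k + j) ((p%:R : Qp) ^ k * t) <-> padic_ideal j t.
Proof.
have pk : (p%:R : Qp) ^ k != 0 by rewrite expfz_neq0 ?padic_p_neq0.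
split=> -[a _].
  rewrite expfzDr ?padic_p_neq0 // -mulrA => /(mulfI pk) <-; by exists a.
by move=> <-; exists a; rewrite // expfzDr ?padic_p_neq0 // mulrA.
Qed.

(** The digit is the residue of [t] modulo [p]; what remains has first residue zero, hence is
    divisible by [p]. *)
Lemma padic_ideal_digit t : padic_ideal 0 t ->
  exists d : 'I_p, padic_ideal 1 (t - d%:R).
Proof.
move=> [a _ <-]; rewrite expr0z mul1r.
have p0 : 0 < (p : int) by rewrite ltz_nat prime_gt0.
have a1 : a 1%N = (a 1%N %% p)%Z by rewrite -{1}(residue_id a 1) expn1.
have lt1 : (`|a 1%N|%N < p)%N.
  by rewrite -ltz_nat gez0_abs a1 ?ltz_pmod ?modz_ge0 ?gt_eqF.
have a1E : (`|a 1%N|%N : int) = a 1%N.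
  by rewrite gez0_abs // a1 modz_ge0 // gt_eqF.
exists (Ordinal lt1) => /=.
have /padic_int_dvdp[b ab] : (a - (`|a 1%N|%N)%:R) 1%N = 0.
  rewrite residueD residueN residue_nat a1E !expn1.
  by rewrite modzDmr -a1 subrr mod0z.
by exists b => //; rewrite expr1z -(rmorph_nat (@padic_embed p p_pr)) -rmorphM
  -[p%:R]expr1 -ab rmorphB rmorph_nat.
Qed.

Lemma padic_digit_inj (d e : 'I_p) :
  padic_ideal 1 (d%:R - e%:R : Qp) -> d = e.
Proof.
move=> [c _]; rewrite expr1z -!(rmorph_nat (@padic_embed p p_pr)).
rewrite -rmorphM -rmorphB => /padic_embed_inj/esym/eqP; rewrite subr_eq => /eqP.
move=> /(congr1 (fun a : Zp => a 1%N)).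
rewrite residueD residueM !residue_nat expn1 modzz mul0r mod0z add0r modz_mod.
rewrite !modz_small ?ltz_nat ?ltn_ord // => -[ed].
exact/esym/val_inj.
Qed.

Variable n : nat.
Local Notation Qpn := 'rV[Qp]_n.
Implicit Types x y z : Qpn.

Lemma latticeP k x : lattice k x <-> forall i, padic_ideal k (x 0 i).
Proof.
split=> [[a _ <-] i|kx]; first by exists (a 0 i); rewrite // !mxE.
pose a : 'rV[Zp]_n := \row_i projT1 (cid2 (kx i)).
by exists a => //; apply/rowP => i; rewrite !mxE; case: cid2.
Qed.

Lemma lattice0 k : lattice k (0 : Qpn).
Proof. by apply/latticeP => i; rewrite mxE; exact: padic_ideal0. Qed.

Lemma latticeB k x y : lattice k x -> lattice k y -> lattice k (x - y).
Proof.
move=> /latticeP kx /latticeP ky; apply/latticeP => i.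
by rewrite !mxE; exact: padic_idealB.
Qed.

Lemma latticeN k x : lattice k x -> lattice k (- x).
Proof. by rewrite -[- x]add0r; apply: latticeB; exact: lattice0. Qed.

Lemma latticeD k x y : lattice k x -> lattice k y -> lattice k (x + y).
Proof. by move=> kx /latticeN ky; rewrite -[y]opprK; exact: latticeB. Qed.

Lemma lattice_le k j : k <= j -> lattice j `<=` (lattice k : set Qpn).
Proof.
move=> kj x /latticeP jx; apply/latticeP => i.
exact: padic_ideal_le kj _ (jx i).
Qed.

Lemma lattice_shift k j x :
  lattice (k + j) ((p%:R : Qp) ^ k *: x) <-> lattice j x.
Proof.
by rewrite !latticeP; split=> h i; have := h i; rewrite mxE padic_ideal_shift.
Qed.

Lemma cosetxx k x : coset k x x.
Proof. by rewrite /coset /= subrr; exact: lattice0. Qed.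

Lemma coset_sym k x y : coset k x y -> coset k y x.
Proof. by rewrite /coset /= => /latticeN; rewrite opprB. Qed.

Lemma coset_trans k y x z : coset k x y -> coset k y z -> coset k x z.
Proof. by rewrite /coset /= => xy /latticeD /(_ xy); rewrite subrKA. Qed.

Lemma coset_le k j x : k <= j -> coset j x `<=` coset k x.
Proof. by move=> kj y; exact: lattice_le. Qed.

Lemma coset_eq k x y : coset k x y -> coset k x = coset k y.
Proof.
move=> xy; apply/seteqP; split=> z; last exact: coset_trans.
exact: coset_trans (coset_sym xy).
Qed.

Lemma coset_zero k : coset k (0 : Qpn) = lattice k.
Proof. by apply/seteqP; split=> y; rewrite /coset /= subr0. Qed.

Definition child k x (a : 'rV['I_p]_n) : Qpn :=
  x + (p%:R : Qp) ^ k *: digits p_pr a.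

Lemma lattice_digits a : lattice 0 (digits p_pr a : Qpn).
Proof.
apply/latticeP => i; exists (a 0 i : nat)%:R => //.
by rewrite expr0z mul1r rmorph_nat mxE.
Qed.

Lemma child_coset k x a : coset k x (child k x a).
Proof.
rewrite /coset /= /child addrC addKr -[X in lattice X]addr0 lattice_shift.
exact: lattice_digits.
Qed.

(** Rescaling by [p ^ (- k)] moves [y - x] into the integral lattice, where a digit is chosen for
    each coordinate separately. *)
Lemma child_ex k x y : coset k x y -> exists a, coset (k + 1) (child k x a) y.
Proof.
rewrite /coset /= => kxy; pose z := (p%:R : Qp) ^ (- k) *: (y - x).
have yE : y = x + (p%:R : Qp) ^ k *: z.
  by rewrite /z scalerA -expfzDr ?padic_p_neq0 // subrr expr0z scale1r subrKC.
have /latticeP z0 : lattice 0 z by rewrite -[0](addNr k) lattice_shift.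
have [d dP] := choice (fun i => padic_ideal_digit (z0 i)).
exists (\row_i d i); rewrite /child yE opprD addrACA subrr add0r -scalerBr.
rewrite lattice_shift; apply/latticeP => i; have := dP i; rewrite !mxE; exact.
Qed.

Lemma child_inj k x a b :
  coset (k + 1) (child k x a) (child k x b) -> a = b.
Proof.
rewrite /coset /= /child opprD addrACA subrr add0r -scalerBr lattice_shift.
move=> /latticeP h; apply/rowP => i; apply: esym.
by have := h i; rewrite !mxE => /padic_digit_inj.
Qed.

Lemma coset_children k x :
  coset k x = \bigcup_(a in [set: 'rV['I_p]_n]) coset (k + 1) (child k x a).
Proof.
apply/seteqP; split=> [y /child_ex[a ay]|y [a _ ay]]; first by exists a.
by apply: coset_trans (child_coset k x a) _; apply: coset_le ay; rewrite lerDl.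
Qed.

Lemma child_trivIset k x :
  trivIset [set: 'rV['I_p]_n] (fun a => coset (k + 1) (child k x a)).
Proof.
move=> a b _ _ [y [ay cy]].
exact: child_inj (coset_trans ay (coset_sym cy)).
Qed.

Lemma vertex_eqP (v w : vertex p_pr n) :
  level v = level w -> cell v = cell w -> v = w.
Proof.
case: v w => [k A hA] [j B hB] /= kj AB; move: hA hB; rewrite kj AB => hA hB.
by congr Vertex; exact: Prop_irrelevance.
Qed.

Lemma vtx_eq k x y : coset k x y -> vtx x k = vtx y k.
Proof. by move=> xy; apply: vertex_eqP => //=; exact: coset_eq. Qed.

Lemma vtx_inj k j x y : vtx x k = vtx y j -> k = j /\ coset k x y.
Proof.
move=> e; have /= kj := congr1 (@level _ _ _) e.
have /= := congr1 (@cell _ _ _) e; rewrite -kj => ->.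
by split=> //; exact: cosetxx.
Qed.

Lemma vtxP (v : vertex p_pr n) : exists x, v = vtx x (level v).
Proof. by have [x xE] := cellP v; exists x; exact: vertex_eqP. Qed.

End Lattice.

(** * Cosets as a basis of compact open sets, and test functions *)

Section Topology.
Variables (p : nat) (p_pr : prime p) (n : nat).
Local Notation Zp := (padic_int p_pr).
Local Notation Qp := (padic p_pr).
Local Notation Qpn := 'rV[Qp]_n.
Implicit Types (k j : int) (x y z : Qpn).

Lemma prime_expz_lt (e : rat) :
  0 < e -> exists m : nat, (p%:R : rat) ^ (- m%:Z) < e.
Proof.
move=> e0; have p0 : (0 : rat) < p%:R by rewrite ltr0n prime_gt0.
exists (Num.bound e^-1); rewrite -invr_expz invf_plt ?posrE ?exprz_gt0 //.
apply: lt_le_trans (archi_boundP _) _; first by rewrite invr_ge0 ltW.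
by rewrite -exprnP -natrX ler_nat ltnW // ltn_expl // prime_gt1.
Qed.

(** Row vectors carry the maximum metric, so a coset of level [k] is the closed ball of radius
    [p ^ (- k)]; passing between open and closed balls only changes the radius. *)
Lemma nbhs_coset x (A : set Qpn) :
  nbhs x A <-> exists k, coset k x `<=` A.
Proof.
split=> [/nbhs_ballP[e /= e0 xeA]|[k kxA]].
  have [m me] := prime_expz_lt e0; exists m => y xy; apply: xeA.
  split=> // i j; rewrite ballEmdist /= [mdist _ _]padic_dist_sym.
  apply: le_lt_trans me; apply/padic_norm_le.
  by move: xy => /latticeP/(_ j); rewrite !mxE ord1.
apply/nbhs_ballP; exists (p%:R ^ (- k)) => /=.
  by rewrite exprz_gt0 // ltr0n prime_gt0.
move=> y [_ xy]; apply: kxA; apply/latticeP => i; rewrite !mxE.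
have := xy 0 i; rewrite ballEmdist /= [mdist _ _]padic_dist_sym => /ltW.
by move/padic_norm_le.
Qed.

Lemma open_cosets (A : set Qpn) k :
  (forall x y, A x -> coset k x y -> A y) -> open A.
Proof.
by move=> kA; rewrite openE => x Ax; apply/nbhs_coset; exists k => y; exact: kA.
Qed.

Lemma open_coset k x : open (coset k x).
Proof. by apply: (@open_cosets _ k) => y z; exact: coset_trans. Qed.

Lemma locally_constant_continuous (T : topologicalType) k (f : Qpn -> T) :
  (forall x y, coset k x y -> f y = f x) -> continuous f.
Proof.
move=> fk x A /nbhs_singleton Afx; apply/nbhs_coset; exists k => y /fk.
by rewrite /= => ->.
Qed.

(** Completeness of the p-adic integers: the diagonal residues are compatible, so they define an
    element. *)
Lemma padic_int_limit (a : nat -> Zp) :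
  (forall m, a m.+1 m = a m m) ->
  exists b : Zp, forall m, b m = a m m.
Proof.
move=> am; have bP m : a m m = (a m.+1 m.+1 %% (p ^ m)%N)%Z.
  by rewrite -residueP am.
by exists (PadicInt p_pr bP).
Qed.

Local Notation embed := (map_mx (@padic_embed p p_pr)).

Lemma lattice_embed (m : nat) (a : 'rV[Zp]_n) :
  lattice m (embed a : Qpn) <-> forall i, a 0 i m = 0.
Proof.
rewrite latticeP; split=> [ma i|ma i]; last first.
  rewrite mxE; have [b ->] := padic_int_dvdp (ma i).
  by exists b; rewrite // rmorphM rmorphXn rmorph_nat.
have [b _] := ma i; rewrite mxE -exprnP -(rmorph_nat (@padic_embed p p_pr)).
rewrite -rmorphXn -rmorphM => /padic_embed_inj <-.
by rewrite -natrX residueM residue_nat modzz mul0r mod0z.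
Qed.

(** An ultrafilter on the lattice selects one coset at every natural level; the selected cosets are
    nested, and completeness provides a common point, to which the ultrafilter converges. *)
Lemma compact_lattice0 : compact (lattice 0 : set Qpn).
Proof.
rewrite compact_ultra => F FU F0; have FF := @ultra_proper _ _ FU.
(* If [F] contained no child, it would contain the finitely many complements, whose intersection
   misses the coset. *)
have stepF k y : F (coset k y) -> exists d, F (coset (k + 1) (child k y d)).
  move=> Fy; apply: contrapT => /forallNP NF.
  have /(filterI Fy)/filter_ex[z [/child_ex[d dz] /(_ d)]] :
    \forall z \near F, forall d, (~` coset (k + 1) (child k y d)) z; last exact.
  apply: filter_forall => d.
  by have [/NF|] := in_ultra_setVsetC (coset (k + 1) (child k y d)) FU.
have /choice[a Fa] :
    forall m : nat, exists a : 'rV[Zp]_n, F (coset m (embed a)).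
  elim=> [|m [a /stepF[d Fd]]].
    by exists 0; rewrite map_mx0 coset_zero.
  exists (a + p%:R ^+ m *: map_mx (fun d : 'I_p => (d : nat)%:R) d).
  rewrite -addn1 PoszD.
  suff -> : embed (a + p%:R ^+ m *: map_mx (fun d : 'I_p => (d : nat)%:R) d) =
    child m (embed a) d by [].
  apply/rowP => i; rewrite !mxE rmorphD rmorphM rmorphXn !rmorph_nat.
  by rewrite exprnP.
(* Two sets of [F] meet, so the centers of consecutive cosets agree modulo [p ^ m]. *)
have aE i m : a m.+1 0 i m = a m 0 i m.
  have [z [mz m1z]] := filter_ex (filterI (Fa m) (Fa m.+1)).
  have {}m1z := coset_le _ m1z; have {m1z} := m1z m.
  rewrite lez_nat leqnSn => /(_ isT)/coset_sym/(coset_trans mz).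
  rewrite /coset /= -map_mxB lattice_embed => /(_ i)/eqP.
  rewrite !mxE residueD residueN modzDmr => /eqP/dvdz_mod0P.
  by rewrite -eqz_mod_dvd => /eqP; rewrite !residue_id.
have [b bE] := choice (fun i => padic_int_limit (aE i)).
exists (embed (\row_i b i)); split.
  by exists (\row_i b i); rewrite // expr0z scale1r.
move=> A /nbhs_coset[k kA]; apply: filterS kA _.
(* The level [k] may be negative, whereas the selected cosets have natural levels. *)
have : coset `|k|%N (embed (\row_i b i)) `<=` coset k (embed (\row_i b i)).
  by apply: coset_le; rewrite abszE ler_norm.
move=> /filterS; apply.
suff /coset_eq <- : coset `|k|%N (embed (a `|k|%N)) (embed (\row_i b i)) by [].
rewrite /coset /= -map_mxB lattice_embed => i.
by rewrite !mxE residueD residueN bE modzDmr subrr mod0z.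
Qed.

Lemma compact_coset k x : compact (coset k x).
Proof.
pose f y : Qpn := x + (p%:R : Qp) ^ k *: y.
have -> : coset k x = f @` lattice 0.
  apply/seteqP; split=> [y|_ [y y0 <-]].
    move=> xy; exists ((p%:R : Qp) ^ (- k) *: (y - x)).
      by rewrite -[0](addNr k) lattice_shift.
    rewrite /f scalerA -expfzDr ?padic_p_neq0 // subrr expr0z scale1r.
    exact: subrKC.
  rewrite /coset /= /f addrC addKr.
  by move: y0 => /lattice_shift -/(_ k); rewrite addr0.
apply: continuous_compact; last exact: compact_lattice0.
apply: continuous_subspaceT => y A /nbhs_coset[j jA]; apply/nbhs_coset.
exists (j - k) => z yz; apply: jA; rewrite /coset /= /f opprD addrACA subrr.
by rewrite add0r -scalerBr -(subrKC k j) lattice_shift.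
Qed.

Variable R : realType.

(** These indicators are the test functions that will detect the limit of the cell averages of a
    solution. *)
Lemma C0_coset k x : C0 (\1_(coset k x) : Qpn -> R).
Proof.
split.
  apply: (@locally_constant_continuous _ k) => y z yz; rewrite !indicE.
  congr (_%:R); congr nat_of_bool; apply/idP/idP; rewrite !inE => h.
    exact: coset_trans h (coset_sym yz).
  exact: coset_trans h yz.
move=> e e0; exists (coset k x); first exact: compact_coset.
by move=> y Ny; rewrite indicE memNset //= normr0.
Qed.

Lemma C0_bounded (f : Qpn -> R) : C0 f -> exists M, forall x, `|f x| <= M :> R.
Proof.
move=> [cf /(_ 1 ltr01)[K cK fK]].
have /compact_bounded[M [_ MfK]] : compact (f @` K).
  by apply: continuous_compact cK; exact: continuous_subspaceT.
exists (Num.max 1 (M + 1)) => x; have [Kx|/fK/ltW] := pselect (K x).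
  rewrite le_max; apply/orP; right.
  by apply: (MfK (M + 1)); [rewrite ltrDl|exists x].
by rewrite le_max => ->.
Qed.

Lemma continuous_measurable_padic (f : Qpn -> R) : continuous f ->
  measurable_fun setT (f : padic_space p_pr n -> R).
Proof.
move=> /continuousP cf; apply: (measurability _ (RGenOpens.measurableE R)).
move=> _ [_ [a [b ->] <-]]; rewrite setTI; apply: sub_sigma_algebra.
exact/cf/interval_open.
Qed.

Lemma measurable_coset k x : measurable (coset k x : set (padic_space p_pr n)).
Proof. by apply: sub_sigma_algebra; exact: open_coset. Qed.

End Topology.

(** * The Laplacian in terms of averages over children *)

Section Harmonic.
Variables (p : nat) (p_pr : prime p) (n : nat) (R : realType) (s : R).
Local Notation Qpn := 'rV[padic p_pr]_n.
Local Notation vert := (vertex p_pr n).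
Implicit Types (k : int) (x y : Qpn) (P : vert -> R).

Lemma prime_gt0R : (0 : R) < p%:R. Proof. by rewrite ltr0n prime_gt0. Qed.

Lemma prime_neq0R : (p%:R : R) != 0.
Proof. by rewrite gt_eqF // prime_gt0R. Qed.

Lemma layer_coset P k x y : coset k x y -> layer P k y = layer P k x.
Proof. by move=> /vtx_eq xy; rewrite /layer xy. Qed.

(** The neighbor relations quantify over representatives of a vertex; all of them yield the same
    neighbors, so [x] can be kept fixed. *)
Lemma neighborsE k x : neighbors (vtx x k) =
  [set vtx x (k - 1)] `|` range (fun a => vtx (child k x a) (k + 1)).
Proof.
apply/seteqP; split=> u.
  move=> [[y [j [/vtx_inj[<- xy] ->]]]|[y [j [a [/vtx_inj[<- xy] ->]]]]].
    left => /=; apply/esym/vtx_eq; apply: coset_le xy; lia.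
  right; have [b bP] := child_ex (coset_trans xy (child_coset k y a)).
  by exists b; [exact: I|exact: (vtx_eq bP)].
move=> [->|[a _ <-]]; first by left; exists x, k.
by right; exists x, k, a.
Qed.

Lemma laplacianE P k x : laplacian s P (vtx x k) =
  p%:R `^ (k%:~R * (s - n%:R)) * (layer P (k - 1) x - layer P k x) +
  p%:R `^ ((k + 1)%:~R * (s - n%:R)) *
    \sum_a (layer P (k + 1) (child k x a) - layer P k x).
Proof.
have finC : finite_set (range (fun a => vtx (child k x a) (k + 1))).
  exact: finite_image.
rewrite /laplacian neighborsE fsbigU0 //=; last first.
  by move=> u [/= -> [a _ /vtx_inj[]]]; lia.
rewrite fsbig_set1 /weight /= (max_idPr _); last by lia.
congr (_ + _); rewrite fsbig_image; last first.
  by move=> a b _ _ /vtx_inj[_]; exact: child_inj.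
rewrite setT_index_enum -fsbig_seq ?index_enum_uniq // big_distrr /=.
apply: eq_bigr => a _.
by rewrite (max_idPl _) //; lia.
Qed.

(* The average of the layer [k + m] over the cell [(x, k)]. *)
Fixpoint cell_average P m k x : R :=
  if m is m'.+1 then
    (p%:R ^+ n)^-1 * \sum_a cell_average P m' (k + 1) (child k x a)
  else layer P k x.

Lemma cell_averageS P m k x : cell_average P m.+1 k x =
  (p%:R ^+ n)^-1 * \sum_a cell_average P m (k + 1) (child k x a).
Proof. by []. Qed.

Lemma card_digits : #|{: 'rV['I_p]_n}| = (p ^ n)%N.
Proof. by rewrite card_mx card_ord mul1n. Qed.

Lemma weightS k : p%:R `^ ((k + 1)%:~R * (s - n%:R)) =
  p%:R `^ (k%:~R * (s - n%:R)) * (p%:R `^ s / p%:R ^+ n) :> R.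
Proof.
rewrite intrD mulrDl mul1r powRD; last by rewrite prime_neq0R implybT.
rewrite powRD; last by rewrite prime_neq0R implybT.
by rewrite powRN powR_mulrn // ltW // prime_gt0R.
Qed.

Lemma sum_digits_cst (c : R) :
  (p%:R ^+ n)^-1 * \sum_(a : 'rV['I_p]_n) c = c.
Proof.
rewrite sumr_const card_digits -[c *+ _]mulr_natl natrX mulKf //.
by rewrite expf_neq0 // prime_neq0R.
Qed.

(** Consecutive weights have ratio [p^s / p^n], and the factor [1 / p^n] turns the sum over the
    [p^n] children into their average; the common weight then cancels. *)
Lemma harmonic_average P k x : laplacian s P (vtx x k) = 0 <->
  layer P (k - 1) x - layer P k x +
  p%:R `^ s * (cell_average P 1 k x - layer P k x) = 0.
Proof.
rewrite laplacianE weightS -mulrA -mulrDr.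
have w0 : p%:R `^ (k%:~R * (s - n%:R)) != 0 :> R.
  by rewrite gt_eqF // powR_gt0 // prime_gt0R.
rewrite sumrB -(mulrA _ _^-1) [_^-1 * _]mulrBr sum_digits_cst /=.
split=> [/eqP|->]; last by rewrite mulr0.
by rewrite mulf_eq0 (negbTE w0) => /eqP.
Qed.

(** * Iterated averages of a harmonic function *)

Section Average.
Variable P : vert -> R.
Hypothesis harmP : forall v, laplacian s P v = 0.
Local Notation avg := (cell_average P).
Local Notation r := (p%:R `^ (- s) : R).

Lemma powRNs_inv : p%:R `^ s = r^-1.
Proof. by rewrite powRN invrK. Qed.

Lemma powRNs_gt0 : 0 < r. Proof. by rewrite powR_gt0 // prime_gt0R. Qed.

(** For [m = 0] this is harmonicity at each child of the cell, whose upper neighbor is the cell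
    itself, averaged over the children; larger [m] follow by averaging over children again. *)
Lemma cell_average_step m k x :
  avg m.+2 k x - avg m.+1 k x = r * (avg m.+1 k x - avg m k x).
Proof.
elim: m k x => [|m IHm] k x; last first.
  rewrite !(cell_averageS P _ k x) -!mulrBr -!sumrB mulrCA.
  by congr (_ * _); rewrite big_distrr; apply: eq_bigr => a _; exact: IHm.
have h a : avg 1 (k + 1) (child k x a) - avg 0 (k + 1) (child k x a) =
    r * (avg 0 (k + 1) (child k x a) - layer P k x).
  have := (harmonic_average P (k + 1) (child k x a)).1 (harmP _).
  rewrite addrK (layer_coset P (child_coset k x a)) powRNs_inv /= => e.
  apply: (mulfI (invr_neq0 (lt0r_neq0 powRNs_gt0))); rewrite mulKf; last first.
    by rewrite lt0r_neq0 // powRNs_gt0.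
  by apply/eqP; rewrite -subr_eq0 -[X in _ == X]e; apply/eqP; ring.
rewrite !(cell_averageS P _ k x) -mulrBr -sumrB (eq_bigr _ (fun a _ => h a)).
by rewrite -big_distrr /= sumrB mulrCA mulrBr sum_digits_cst.
Qed.

(** Harmonicity at the cell itself starts the geometric progression, with the upper neighbor as the
    term before [avg 0]; [cell_average_step] continues it. *)
Lemma cell_average_diff m k x :
  avg m.+1 k x - avg m k x = r ^+ m.+1 * (layer P k x - layer P (k - 1) x).
Proof.
elim: m => [|m IHm]; last by rewrite cell_average_step IHm mulrA -exprS.
have /= := (harmonic_average P k x).1 (harmP _); rewrite powRNs_inv => e.
apply: (mulfI (invr_neq0 (lt0r_neq0 powRNs_gt0))).
rewrite expr1 mulKf; last first.
  by rewrite lt0r_neq0 // powRNs_gt0.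
by apply/eqP; rewrite -subr_eq0 -[X in _ == X]e; apply/eqP; rewrite /=; ring.
Qed.

(** Sum of the geometric progression, with [1 - r] multiplied out to avoid a division. *)
Lemma cell_averageE m k x : (1 - r) * avg m k x =
  layer P k x - r * layer P (k - 1) x
  - r ^+ m.+1 * (layer P k x - layer P (k - 1) x).
Proof.
elim: m => [|m IHm]; first by rewrite /= expr1; ring.
rewrite -[avg m.+1 k x](subrK (avg m k x)) cell_average_diff mulrDr IHm.
by rewrite [r ^+ m.+2]exprS; ring.
Qed.

Hypothesis s_gt0 : 0 < s.

Lemma powRNs_lt1 : r < 1.
Proof.
rewrite powRN invf_lt1 ?powR_gt0 ?prime_gt0R //.
have := @gt0_ltr_powR R s s_gt0 1 p%:R; rewrite powR1 !nnegrE; apply => //.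
by rewrite ltr1n prime_gt1.
Qed.

End Average.

End Harmonic.

(** * Norm and valuation on shells *)

Section Norm.
Variables (p : nat) (p_pr : prime p) (n : nat).
Local Notation Qpn := 'rV[padic p_pr]_n.
Implicit Types (j k : int) (x y : Qpn).

Lemma vec_val_ge k y : (k%:E <= vec_val y)%E <-> lattice k y.
Proof.
rewrite latticeP; split=> [/bigmin_geP[_ ky] i|ky].
  by apply/padic_val_ge; exact: ky.
apply/bigmin_geP; split=> [|i _]; first exact: leey.
exact/padic_val_ge.
Qed.

Lemma vec_norm_le k y : vec_norm y <= p%:R ^ (- k) <-> lattice k y.
Proof.
rewrite latticeP; split=> [/bigmax_leP[_ ky] i|ky].
  by apply/padic_norm_le; exact: ky.
apply/bigmax_leP; split=> [|i _]; first by rewrite exprz_ge0.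
exact/padic_norm_le.
Qed.

(** The vectors of valuation exactly [j], on which each layer of the kernel is constant. *)
Definition shell j : set Qpn := [set y | lattice j y /\ ~ lattice (j + 1) y].

Lemma vec_norm_shell j y : shell j y -> vec_norm y = p%:R ^ (- j).
Proof.
move=> [jy Njy]; apply/le_anti/andP; split; first exact/vec_norm_le.
(* Such a coordinate has valuation exactly [j] and attains the maximum. *)
have [i Ni] : exists i, ~ padic_ideal (j + 1) (y 0 i).
  by apply: contrapT => /forallNP h; apply/Njy/latticeP => i; apply: contrapT.
apply: le_trans (le_bigmax _ _ i); rewrite /padic_norm.
have /padic_val_ge := (latticeP j y).1 jy i.
have {Ni} : ~~ ((j + 1)%:E <= padic_val (y 0%R i))%E.
  by apply/negP => /padic_val_ge.
case E: (padic_val (y 0 i)) => [m| |]; rewrite ?leey ?leeNy_eq // !lee_fin.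
by move=> ? ?; rewrite (_ : m = j) //; lia.
Qed.

(** Take the smallest [m] such that [y] lies in [lattice (k - m)]; it is positive by assumption, and
    [k - m] works by minimality. *)
Lemma shell_ex k y : ~ lattice k y -> exists2 j, j < k & shell j y.
Proof.
move=> Nky; have p0 : (0 : rat) < p%:R by rewrite ltr0n prime_gt0.
have [m0 m0y] : exists m : nat, lattice (k - m%:Z) y.
  (* A power [p ^ (- m)] below this bound gives [vec_norm y < p ^ (m - k)]; the added 1 makes the
     denominator visibly positive. *)
  have e0 : (0 : rat) < p%:R ^ (- k) / (1 + vec_norm y).
    by rewrite divr_gt0 ?exprz_gt0 // ltr_pwDl // bigmax_ge_id.
  have [m] := prime_expz_lt p_pr e0; rewrite ltr_pdivlMr; last first.
    by rewrite ltr_pwDl // bigmax_ge_id.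
  move=> mlt; exists m; apply/vec_norm_le.
  rewrite opprB addrC expfzDr ?gt_eqF // -ler_pdivrMr ?exprz_gt0 //.
  rewrite invr_expz mulrC; apply/ltW/(le_lt_trans _ mlt).
  by rewrite ler_wpM2l ?exprz_ge0 // lerDr.
have /ex_minnP[[|m]] : exists m : nat, `[< lattice (k - m%:Z) y >].
  by exists m0; exact/asboolP.
- by rewrite subr0 => /asboolP.
move=> /asboolP my min_m; exists (k - m.+1%:Z); first by lia.
split=> // h; have /min_m : `[< lattice (k - m%:Z) y >].
  by apply/asboolP; move: h; rewrite (_ : _ + 1 = k - m%:Z) //; lia.
by rewrite ltnn.
Qed.

Lemma lattice_coset k x y : coset k x y -> lattice k y <-> lattice k x.
Proof.
move=> xy; split=> [ky|kx]; last by rewrite -(subrK x y); exact: latticeD.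
by rewrite -(subKr y x); apply: latticeB.
Qed.

Lemma shell_coset k j x y : j < k -> coset k x y -> shell j x -> shell j y.
Proof.
move=> jk xy [jx Njx]; split.
  by apply/(lattice_coset _).2: jx; apply: coset_le xy; lia.
by move/(lattice_coset _).1 => h; apply/Njx/h; apply: coset_le xy; lia.
Qed.

End Norm.

(** * The explicit kernel and its recursion *)

Section Kernel.
Variables (p : nat) (p_pr : prime p) (n : nat) (R : realType) (s : R).
Local Notation Qpn := 'rV[padic p_pr]_n.
Local Notation vert := (vertex p_pr n).
Local Notation r := (p%:R `^ (- s) : R).
Local Notation q := (p%:R ^+ n : R).
Implicit Types (j k : int) (x y : Qpn).
Hypothesis s_gt0 : 0 < s.

Definition kernel_const : R := (1 - r) / (1 - r / q).

Let r_gt0 : 0 < r. Proof. exact: powRNs_gt0. Qed.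
Let r_neq0 : r != 0. Proof. exact: lt0r_neq0. Qed.
Let r_lt1 : r < 1. Proof. exact: powRNs_lt1. Qed.
Let q_gt0 : 0 < q. Proof. by rewrite exprn_gt0 // prime_gt0R. Qed.
Let q_ge1 : 1 <= q. Proof. by rewrite exprn_ege1 // ler1n prime_gt0. Qed.
Let q_neq0 : q != 0. Proof. exact: lt0r_neq0. Qed.

Let rq_lt1 : r / q < 1.
Proof. by rewrite ltr_pdivrMr // mul1r (lt_le_trans r_lt1). Qed.

Lemma kernel_const_gt0 : 0 < kernel_const.
Proof. by rewrite divr_gt0 // subr_gt0. Qed.

Let powRDp (a b : R) : p%:R `^ (a + b) = p%:R `^ a * p%:R `^ b :> R.
Proof. by rewrite powRD // (prime_neq0R p_pr) implybT. Qed.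

Let powRMz (a : R) (z : int) : p%:R `^ (a * z%:~R) = (p%:R `^ a) ^ z :> R.
Proof. by rewrite powRrM powR_intmul // powR_ge0. Qed.

Let powRn : p%:R `^ n%:R = q :> R.
Proof. by rewrite powR_mulrn. Qed.

Lemma kernel_constE :
  (1 - p%:R `^ (- s)) / (1 - p%:R `^ (- (s + n%:R))) = kernel_const.
Proof. by rewrite opprD powRDp (powRN _ n%:R) powRn. Qed.

Lemma poisson_kernel_lattice k y :
  lattice k y -> poisson_kernel s k y = kernel_const * q ^ k.
Proof.
move=> /vec_val_ge ky; rewrite /poisson_kernel ky kernel_constE.
by rewrite powRMz powRn.
Qed.

(** As [vec_norm y = p ^ (- j)], the two powers of [p] regroup into powers of [r] and [q]. In this
    form the level [k] enters only through a power of [r]. *)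
Lemma poisson_kernel_shell j k y : j < k -> shell j y ->
  poisson_kernel s k y = kernel_const * (r ^ (k - j) * q ^ j).
Proof.
move=> jk jy; rewrite /poisson_kernel kernel_constE ifF; last first.
  apply/negbTE/negP => /vec_val_ge ky; apply: jy.2.
  by apply: lattice_le ky; lia.
have -> : ratr (vec_norm y) = p%:R `^ (- j%:~R) :> R.
  by rewrite (vec_norm_shell jy) fmorphXz rmorph_nat -intrN powR_intmul.
rewrite -powRrM powRMz; congr (_ * _).
have -> : - j%:~R * (- s - n%:R) = - s * (- j)%:~R + n%:R * j%:~R :> R.
  by rewrite intrN; ring.
by rewrite powRDp !powRMz powRn expfzDr // mulrA.
Qed.

Lemma poisson_kernel_coset k x y :
  coset k x y -> poisson_kernel s k y = poisson_kernel s k x.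
Proof.
move=> xy; have [kx|Nkx] := pselect (lattice k x).
  by rewrite !poisson_kernel_lattice //; exact/(lattice_coset xy).
have [j jk jx] := shell_ex Nkx.
by rewrite !(poisson_kernel_shell jk) //; exact: shell_coset xy jx.
Qed.

Lemma poisson_kernel_ge0 k y : 0 <= poisson_kernel s k y.
Proof.
have C0 := ltW kernel_const_gt0.
have [ky|/shell_ex[j jk jy]] := pselect (lattice k y).
  by rewrite poisson_kernel_lattice // mulr_ge0 // exprz_ge0 // ltW.
rewrite (poisson_kernel_shell jk) // mulr_ge0 // mulr_ge0 // exprz_ge0 //;
  exact: ltW.
Qed.

(** The bound is the value on the central lattice; on a shell with [j < k], [r ^ (k - j)] is at most
    1 and [q ^ j] at most [q ^ k]. *)
Lemma poisson_kernel_le k y : poisson_kernel s k y <= kernel_const * q ^ k.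
Proof.
have [ky|/shell_ex[j jk jy]] := pselect (lattice k y).
  by rewrite poisson_kernel_lattice.
rewrite (poisson_kernel_shell jk) // ler_pM2l ?kernel_const_gt0 //.
rewrite -[leRHS]mul1r ler_pM ?exprz_ge0 ?(ltW r_gt0) ?(ltW q_gt0) //.
  have [m ->] : exists m : nat, k - j = m by exists `|k - j|%N; lia.
  by rewrite -exprnP exprn_ile1 // ltW.
by rewrite ler_weXz2l // ltW.
Qed.

(** Such a [y] lies on a shell of index below both levels, where only the power of [r] depends on
    the level. This makes the mass away from the origin vanish as [k] grows. *)
Lemma poisson_kernel_outside j k y : j <= k -> ~ lattice j y ->
  poisson_kernel s k y = r ^ (k - j) * poisson_kernel s j y.
Proof.
move=> jk /shell_ex[i ij iy].
rewrite !(@poisson_kernel_shell i) //; last by lia.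
by rewrite [RHS]mulrCA [r ^ _ * (_ * _)]mulrA -expfzDr // subrKA.
Qed.

Lemma indic_coset0 k x :
  \1_(coset k x) (0 : Qpn) = (`[< lattice k x >])%:R :> R.
Proof.
rewrite indicE; congr (_%:R); congr nat_of_bool.
apply/idP/asboolP; rewrite inE /coset /= sub0r => kx.
  by rewrite -[x]opprK; exact: latticeN.
exact: latticeN.
Qed.

Lemma poisson_kernel_rec k x : poisson_kernel s k x =
  r * poisson_kernel s (k - 1) x + (1 - r) * q ^ k * \1_(coset k x) 0.
Proof.
rewrite indic_coset0; case: asboolP => [kx|Nkx].
  rewrite !poisson_kernel_lattice //; last by apply: lattice_le kx; lia.
  rewrite mulr1 expfzDr // /kernel_const -[q ^ (-1)]/(q^-1).
  (* Locking [q] lets [field] treat it as an atom; the identity rests on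
     [kernel_const * (1 - r / q) = 1 - r]. *)
  rewrite [q]lock; field; rewrite -lock; apply/andP; split => //.
  by rewrite subr_eq0 gt_eqF // (lt_le_trans r_lt1).
(* The source vanishes here. The shell [k - 1] is treated apart, because there the layer [k - 1]
   still takes its central value. *)
rewrite /= mulr0 addr0; have [kx|Nk1x] := pselect (lattice (k - 1) x).
  rewrite (poisson_kernel_lattice kx) (@poisson_kernel_shell (k - 1));
    last 2 first.
  - by lia.
  - by split; rewrite ?subrK.
  by rewrite subKr expr1z mulrCA.
rewrite (poisson_kernel_outside (j := k - 1)) //; last by lia.
by rewrite subKr expr1z.
Qed.

Lemma sum_indic_children k x y :
  \sum_a \1_(coset (k + 1) (child k x a)) y = \1_(coset k x) y :> R.
Proof.
rewrite [in RHS]indicE; have [xy|Nxy] := pselect (coset k x y).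
  rewrite mem_set //; have [a ay] := child_ex xy.
  have others b : b != a -> \1_(coset (k + 1) (child k x b)) y = 0 :> R.
    move=> /eqP ba; rewrite indicE memNset // => /= yb; apply: ba.
    exact: child_inj (coset_trans yb (coset_sym ay)).
  rewrite (bigD1 a isT) big1 => [|b ba]; last exact: others.
  by rewrite /= addr0 indicE mem_set.
rewrite memNset // big1 // => a _; rewrite indicE memNset // => ay.
by apply: Nxy; rewrite coset_children; exists a.
Qed.

(** A first-order recursion, with a source along the path of cells containing the origin, that
    determines each layer from the one above it. *)
Definition kernel_recursion (P : vert -> R) := forall k x,
  layer P k x = r * layer P (k - 1) x + (1 - r) * q ^ k * \1_(coset k x) 0.

(** Averaging the recursion over the children turns the source factor [q ^ (k + 1)] into [q ^ k],
    since at most one child contains the origin. The average and the layer thus have the same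
    source, and their difference gives the balance of [harmonic_average]. *)
Lemma kernel_recursion_harmonic (P : vert -> R) : kernel_recursion P ->
  forall v, laplacian s P v = 0.
Proof.
move=> recP v; have [x ->] := vtxP v; move: (level v) => k.
apply/harmonic_average => //.
have -> : cell_average P 1 k x =
    r * layer P k x + (1 - r) * q ^ k * \1_(coset k x) 0.
  rewrite cell_averageS /=.
  under eq_bigr => a _ do
    rewrite (recP _ (child k x a)) addrK (layer_coset P (child_coset k x a)).
  rewrite big_split /= mulrDr sum_digits_cst //; congr (_ + _).
  rewrite -big_distrr /= sum_indic_children mulrA; congr (_ * _).
  by rewrite expfzDr // expr1z; field.
rewrite powRNs_inv [layer P k x in LHS]recP.
by field.
Qed.

Lemma kernel_recursion_unique (P Q : vert -> R) :
  kernel_recursion P -> kernel_recursion Q ->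
  (forall x, layer P (- m%:Z) x @[m --> \oo] --> (0 : R)) ->
  (forall x, layer Q (- m%:Z) x @[m --> \oo] --> (0 : R)) -> P = Q.
Proof.
move=> recP recQ P0 Q0; apply/funext => v; have [x ->] := vtxP v.
move: (level v) => k; rewrite -[P _]/(layer P k x) -[Q _]/(layer Q k x).
have D (i : nat) : layer P k x - layer Q k x =
    r ^+ i * (layer P (k - i%:Z) x - layer Q (k - i%:Z) x).
  elim: i => [|i ->]; first by rewrite subr0 mul1r.
  have -> : k - i.+1%:Z = k - i%:Z - 1 by lia.
  by rewrite (recP (k - i%:Z)) (recQ (k - i%:Z)) exprSr; ring.
apply/eqP; rewrite -subr_eq0 -normr_le0.
have PQ0 : `|layer P (- m%:Z) x - layer Q (- m%:Z) x| @[m --> \oo] --> (0 : R).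
  by rewrite -(normr0 R) -(subrr 0); apply: cvg_norm; exact: cvgB (P0 x) (Q0 x).
(* As [r ^ i <= 1], the difference at level [k] is bounded by the one at every level [- m] with
   [m >= |k|], which tends to 0. *)
apply: (cvgr_to_ge PQ0); exists `|k|%N => // m /= km.
have [i ki] : exists i : nat, k - i%:Z = - m%:Z.
  by exists `|(k + m%:Z)%R|%N; lia.
rewrite (D i) ki normrM ler_piMl // normrX exprn_ile1 //.
by rewrite ger0_norm ltW.
Qed.

(** The value is read at a chosen representative of the cell; by [poisson_kernel_coset] it does not
    depend on the choice. *)
Definition kernel_vertex (v : vert) : R :=
  poisson_kernel s (level v) (projT1 (cid (cellP v))).

Lemma layer_kernel_vertex k y : layer kernel_vertex k y = poisson_kernel s k y.
Proof.
rewrite /layer /kernel_vertex; case: cid => x /= yx.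
by apply: poisson_kernel_coset; rewrite yx; exact: cosetxx.
Qed.

Lemma kernel_vertex_recursion : kernel_recursion kernel_vertex.
Proof.
by move=> k x; rewrite !layer_kernel_vertex; exact: poisson_kernel_rec.
Qed.

End Kernel.

(** * Haar measure of cosets and integrals of layers *)

Section Haar.
Variables (p : nat) (p_pr : prime p) (n : nat) (R : realType) (s : R).
Local Notation Qpn := 'rV[padic p_pr]_n.
Local Notation X := (padic_space p_pr n).
Local Notation vert := (vertex p_pr n).
Local Notation r := (p%:R `^ (- s) : R).
Local Notation q := (p%:R ^+ n : R).
Implicit Types (j k : int) (x y : Qpn) (P Q : vert -> R).
Variable mu : {measure set X -> \bar R}.
Hypothesis haar_mu : haar_measure mu.

Let q_gt0 : 0 < q. Proof. by rewrite exprn_gt0 // prime_gt0R. Qed.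
Let q_neq0 : q != 0. Proof. exact: lt0r_neq0. Qed.

Lemma haar_coset_lattice k x : mu (coset k x) = mu (lattice k).
Proof.
have [inv _] := haar_mu; have mk := measurable_coset k (0 : Qpn).
rewrite coset_zero in mk; rewrite -(inv x _ mk); congr (mu _).
apply/seteqP; split=> [y xy|_ [y ky <-]].
  by exists (y - x) => //; rewrite subrKC.
by rewrite /coset /= addrC addKr.
Qed.

(** The [q] children partition the lattice and are translates of a single smaller one. *)
Lemma haar_latticeS k : mu (lattice k) = (q%:E * mu (lattice (k + 1)))%E.
Proof.
rewrite -(haar_coset_lattice k 0) coset_children.
rewrite measure_fin_bigcup //; last 3 first.
- exact: finite_finset.
- exact: child_trivIset.
- by move=> a _; exact: measurable_coset.
rewrite setT_index_enum -fsbig_seq ?index_enum_uniq //.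
rewrite (eq_bigr (fun=> mu (lattice (k + 1)))); last first.
  by move=> a _; exact: haar_coset_lattice.
rewrite big_const card_digits -natrX mule_natl; 
by elim: (p ^ n)%N => // m IHm; rewrite iterS IHm muleS.
Qed.

Lemma haar_coset k x : mu (coset k x) = (q ^ (- k))%:E.
Proof.
rewrite haar_coset_lattice; case: haar_mu => _ mu0.
have step j : mu (lattice (j + 1)) = ((q^-1)%:E * mu (lattice j))%E.
  by rewrite (haar_latticeS j) muleA -EFinM mulVf // mul1e.
have pos (m : nat) : mu (lattice m) = (q ^ (- m%:Z))%:E.
  elim: m => [|m IHm]; first by rewrite oppr0 expr0z mu0.
  rewrite (_ : m.+1%:Z = m%:Z + 1); last by lia.
  rewrite step IHm -EFinM; congr (_%:E).
  by rewrite opprD addrC expfzDr.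
have neg (m : nat) : mu (lattice (- m%:Z)) = (q ^ m%:Z)%:E.
  elim: m => [|m IHm]; first by rewrite oppr0 mu0.
  rewrite haar_latticeS (_ : - m.+1%:Z + 1 = - m%:Z); last by lia.
  by rewrite IHm -EFinM -exprSz.
case: k => m; first exact: pos.
by rewrite NegzE neg opprK.
Qed.

Lemma layer_continuous P k : continuous (layer P k).
Proof.
by apply: (@locally_constant_continuous _ _ _ _ k) => x y; exact: layer_coset.
Qed.

Lemma measurable_layer P k : measurable_fun setT (layer P k : X -> R).
Proof. exact: continuous_measurable_padic (@layer_continuous P k). Qed.

(** Splitting the coset into its children, each with [1 / q] of its measure, matches one unfolding
    of [cell_average]. *)
Lemma integral_coset P k (m : nat) x :
  (\int[mu]_(y in coset k x) (layer P (k + m%:Z) y)%:E =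
   (q ^ (- k) * cell_average P m k x)%:E)%E.
Proof.
elim: m k x => [|m IHm] k x.
  rewrite addr0 (eq_integral (cst (layer P k x)%:E)); last first.
    by move=> y /[!inE] xy; rewrite (layer_coset P xy).
  rewrite integral_cst ?haar_coset /=; last exact: measurable_coset.
  by rewrite -EFinM mulrC.
have trivC := @child_trivIset p p_pr n k x.
rewrite coset_children setT_index_enum in trivC *.
rewrite bigcup_seq integral_bigsetU_EFin //.
- rewrite cell_averageS mulrA big_distrr /= -sumEFin.
  apply: eq_bigr => a _.
  rewrite (_ : k + m.+1%:Z = k + 1 + m%:Z); last by lia.
  by rewrite IHm opprD expfzDr // exprN1.
- by move=> a; exact: measurable_coset.
- exact: index_enum_uniq.
- apply/measurable_EFinP; apply: measurable_funTS; exact: measurable_layer.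
Qed.

End Haar.

(** * Existence and uniqueness of the solution *)

Section PoissonProblem.
Variables (p : nat) (p_pr : prime p) (n : nat) (R : realType) (s : R).
Local Notation Qpn := 'rV[padic p_pr]_n.
Local Notation X := (padic_space p_pr n).
Local Notation vert := (vertex p_pr n).
Local Notation r := (p%:R `^ (- s) : R).
Local Notation q := (p%:R ^+ n : R).
Implicit Types (j k : int) (x y : Qpn) (P Q : vert -> R).
Variable mu : {measure set X -> \bar R}.
Hypothesis haar_mu : haar_measure mu.
Hypothesis s_gt0 : 0 < s.

Let q_gt0 : 0 < q. Proof. by rewrite exprn_gt0 // prime_gt0R. Qed.
Let q_neq0 : q != 0. Proof. exact: lt0r_neq0. Qed.
Let r_gt0 : 0 < r. Proof. exact: powRNs_gt0. Qed.
Let r_lt1 : r < 1. Proof. exact: powRNs_lt1. Qed.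
Let r1_neq0 : 1 - r != 0. Proof. by rewrite subr_eq0 gt_eqF. Qed.

Lemma cvg_powRNs : r ^+ m @[m --> \oo] --> (0 : R).
Proof. by apply: cvg_expr; rewrite ger0_norm // ltW. Qed.

Lemma cell_average_cvg P : (forall v, laplacian s P v = 0) -> forall k x,
  cell_average P m k x @[m --> \oo] -->
    (1 - r)^-1 * (layer P k x - r * layer P (k - 1) x).
Proof.
move=> harmP k x; pose d := layer P k x - layer P (k - 1) x.
have -> : (fun m => cell_average P m k x) = fun m => (1 - r)^-1 *
    (layer P k x - r * layer P (k - 1) x - r ^+ m * (r * d)).
  apply/funext => m; apply: (mulfI r1_neq0); rewrite mulVKf //.
  by rewrite cell_averageE // exprS /d; ring.
apply: cvgMr; move: (layer P k x - _) => L.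
rewrite -[L in _ --> L]subr0 -(mul0r (r * d)).
by apply: cvgB; [exact: cvg_cst|apply: cvgMl; exact: cvg_powRNs].
Qed.

Local Notation K := (kernel_vertex (p_pr := p_pr) (n := n) s).

Let harmK v : laplacian s K v = 0.
Proof.
by apply: kernel_recursion_harmonic; exact: kernel_vertex_recursion.
Qed.

Let K_ge0 k y : 0 <= layer K k y.
Proof. by rewrite layer_kernel_vertex //; exact: poisson_kernel_ge0. Qed.

(** Monotone convergence along balls [B i] exhausting the space: the integral over each is an
    average over a cell centered at the origin, to which [cell_averageE] applies. *)
Lemma integral_kernel k : (\int[mu]_y (layer K k y)%:E = 1)%E.
Proof.
pose B (i : nat) : set X := coset (k - i%:Z) 0.
have BT : \bigcup_i B i = setT.
  apply/seteqP; split=> // y _; rewrite /B.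
  have [ky|/shell_ex[j jk [jy _]]] := pselect (lattice k y).
    by exists 0%N; rewrite // subr0 coset_zero.
  by exists `|k - j|%N; rewrite // coset_zero (_ : k - _ = j) //; lia.
(* The powers of [q] cancel, and [kernel_const * (1 - r / q) = 1 - r] produces the leading 1; the
   rest is a fixed multiple of [r ^ i]. *)
have IB (i : nat) : (\int[mu]_(y in B i) (layer K k y)%:E)%E =
    (1 - r ^+ i * (r * (1 - r)^-1 * (kernel_const p n s * (1 - q^-1))))%:E.
  have := integral_coset haar_mu K (k - i%:Z) i 0; rewrite subrK => ->.
  congr (_%:E); apply: (mulfI r1_neq0); rewrite mulrCA cell_averageE //.
  move: (k - i%:Z) => j; have q1 : q - r != 0.
    rewrite subr_eq0 gt_eqF // (lt_le_trans r_lt1) // exprn_ege1 //.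
    by rewrite ler1n prime_gt0.
  have lat i' : lattice i' (0 : Qpn) by exact: lattice0.
  rewrite !layer_kernel_vertex // !(poisson_kernel_lattice s (lat _)).
  rewrite (expfzDr j (-1)) // -[q ^ (-1)]/(q^-1) -invr_expz exprS /kernel_const.
  move: (q ^ j) (expfz_neq0 j q_neq0) (r ^+ i) => Q Q0 ri.
  move: q1 (q_neq0); rewrite [q]lock => q1 q0; field.
  exact/and4P.
have cvgB1 : (\int[mu]_(y in B i) (layer K k y)%:E)%E @[i --> \oo] --> 1%E.
  under eq_fun do rewrite IB; apply: cvg_EFin; first exact: nearW.
  move: (r * (1 - r)^-1 * _) => c; rewrite -[X in _ --> X]subr0 -(mul0r c).
  by apply: cvgB; [exact: cvg_cst|apply: cvgMl; exact: cvg_powRNs].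
have cvgBT := @ge0_nondecreasing_set_cvg_integral _ X R B
  (fun y => (layer K k y)%:E) mu.
rewrite BT in cvgBT; apply: cvg_unique cvgB1; first exact: ereal_hausdorff.
apply: cvgBT.
- apply/nondecreasing_seqP => i; rewrite subsetEset; apply: coset_le; lia.
- by move=> i; exact: measurable_coset.
- move=> i; apply/measurable_EFinP; apply: measurable_funTS.
  exact: measurable_layer.
- by move=> i y _; rewrite lee_fin.
Qed.

Lemma integrable_kernel k : mu.-integrable setT (EFin \o layer K k).
Proof.
apply/integrableP; split.
  by apply/measurable_EFinP; exact: measurable_layer.
rewrite (eq_integral (fun y : X => (layer K k y)%:E)).
  by rewrite integral_kernel ltry.
by move=> y _; rewrite /= ger0_norm.
Qed.

Lemma integrable_kernelM k (f : Qpn -> R) : C0 f ->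
  mu.-integrable setT (EFin \o (fun y => layer K k y * f y)).
Proof.
move=> f0; have [M fM] := C0_bounded f0.
have := integrableMl measurableT (integrable_kernel k)
  (continuous_measurable_padic f0.1 : measurable_fun _ (f : X -> R)).
apply; exists M; split; first exact: num_real.
by move=> x /ltW Mx y _ /=; exact: le_trans (fM y) Mx.
Qed.

(** Approximate identity: near the origin [f] is close to [f 0], and farther out the layer [m] is
    [r ^ (m - j)] times the layer [j], whose mass is 1. *)
Lemma kernel_weakstar :
  weakstar_cvg mu (fun m : nat => layer K m) (\d_((0 : Qpn) : X)).
Proof.
move=> f f0; have [M fM] := C0_bounded f0; have cf := f0.1.
have M0 : 0 <= M by exact: le_trans (normr_ge0 _) (fM 0).
have mf : measurable_fun setT (f : X -> R).
  exact: continuous_measurable_padic.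
rewrite integral_dirac //; last by apply/measurable_EFinP.
rewrite diracT mul1e.
have intE (m : nat) : (\int[mu]_y (layer K m y * f y)%:E)%E =
    (\int[mu]_y (layer K m y * f y))%:E.
  rewrite /Rintegral fineK // integrable_fin_num //.
  exact: integrable_kernelM.
under eq_fun do rewrite intE.
apply: cvg_EFin; first exact: nearW.
apply/cvgrPdist_le => /= e e0.
have [j jf] : exists j : nat, forall y, lattice j y -> `|f y - f 0| <= e / 2.
  have /cvgrPdist_le/(_ (e / 2)) := cf 0; rewrite divr_gt0 // => /(_ isT).
  move=> /nbhs_coset[j jf]; exists `|j|%N => y jy.
  rewrite distrC; apply: jf; rewrite coset_zero.
  by apply: lattice_le jy; rewrite abszE ler_norm.
have RK (m : int) : \int[mu]_y (layer K m y) = 1.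
  by rewrite /Rintegral integral_kernel.
have bound (m : nat) : (j <= m)%N ->
    `|f 0 - \int[mu]_y (layer K m y * f y)| <= e / 2 + r ^+ (m - j) * (M + M).
  move=> jm.
  have iK := integrable_kernel; have iKf := integrable_kernelM m f0.
  have iKc (i : int) c : mu.-integrable setT
      (EFin \o (fun y => c * layer K i y)).
    exact: (integrableZl measurableT c (integrable_kernel i)).
  have RKc (i : int) c : \int[mu]_y (c * layer K i y) = c.
    by rewrite RintegralZl // RK mulr1.
  have iA : mu.-integrable setT
      (EFin \o (fun y => f 0 * layer K m y - layer K m y * f y)).
    exact: (integrableB measurableT (iKc m (f 0)) iKf).
  have -> : f 0 - \int[mu]_y (layer K m y * f y) =
      \int[mu]_y (f 0 * layer K m y - layer K m y * f y).
    by rewrite RintegralB // RintegralZl // RK mulr1.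
  apply: le_trans (le_normr_Rintegral measurableT iA) _.
  (* Since all layers have mass 1, the bound is itself an integral, and a pointwise comparison of
     integrands suffices. *)
  have -> : e / 2 + r ^+ (m - j) * (M + M) = \int[mu]_y
      (e / 2 * layer K m y + r ^+ (m - j) * (M + M) * layer K j y).
    apply/esym; apply: etrans (RintegralD measurableT (iKc m _) (iKc j _)) _.
    by congr (_ + _); exact: RKc.
  apply: le_Rintegral => //.
  - have := integrable_abse iA; exact: eq_integrable.
  - exact: (integrableD measurableT (iKc m (e / 2)) (iKc j _)).
  - move=> y _; rewrite [f 0 * _]mulrC -mulrBr normrM ger0_norm //.
    have [jy|Njy] := pselect (lattice j y).
      rewrite -[leLHS]addr0 lerD //.
        by rewrite mulrC ler_wpM2r // distrC jf.
      apply: mulr_ge0 => //; apply: mulr_ge0; last by rewrite addr_ge0.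
      by rewrite exprn_ge0 // ltW.
    rewrite -[leLHS]add0r lerD //; first by rewrite mulr_ge0 // ltW // divr_gt0.
    have jmZ : j%:Z <= m%:Z by rewrite lez_nat.
    rewrite !layer_kernel_vertex // (poisson_kernel_outside s_gt0 jmZ Njy).
    rewrite (subzn jm) -exprnP mulrAC.
    apply: ler_wpM2r; first exact: poisson_kernel_ge0.
    apply: ler_wpM2l; first by rewrite exprn_ge0 // ltW.
    exact: le_trans (ler_normB _ _) (lerD (fM _) (fM _)).
have /cvgrPdist_le/(_ (e / 2)) : r ^+ m * (M + M) @[m --> \oo] --> (0 : R).
  by rewrite -(mul0r (M + M)); apply: cvgMl; exact: cvg_powRNs.
rewrite divr_gt0 // => /(_ isT)[N _ rN].
exists (N + j)%N => // m /= Nm.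
apply: le_trans (bound m _) _; first by apply: leq_trans Nm; exact: leq_addl.
rewrite [leRHS](splitr e) lerD2l.
have /rN /= : (N <= m - j)%N by lia.
by rewrite sub0r normrN; apply: le_trans; exact: ler_norm.
Qed.

(** The layer is constant on a cell of positive measure, so its value there cannot exceed the
    essential supremum. *)
Lemma layer_le_Lnorm P k x :
  (`|layer P k x|%:E <= 'N[mu]_+oo [EFin \o layer P k])%E.
Proof.
have cell_gt0 : (0 < mu (coset k x))%E.
  by rewrite haar_coset // lte_fin exprz_gt0.
(* The norm is an essential supremum only if the whole space has positive measure, which follows
   from that of the cell. *)
rewrite unlock ifT; last first.
  apply: lt_le_trans cell_gt0 _; apply: le_measure; rewrite ?inE //.
  exact: measurable_coset.
have [N [mN N0 subN]] := ess_sup_ge mu (abse \o (EFin \o layer P k)).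
rewrite leNgt; apply/negP => lt_sup; move: cell_gt0; rewrite ltNge -N0.
move/negP; apply; apply: le_measure; rewrite ?inE //.
  exact: measurable_coset.
move=> y xy; apply: subN => /=; apply/negP; rewrite -ltNge.
by rewrite (layer_coset P xy).
Qed.

Lemma decay_pointwise P x :
  ('N[mu]_+oo [EFin \o layer P (- m%:Z)] @[m --> \oo] --> 0)%E ->
  layer P (- m%:Z) x @[m --> \oo] --> (0 : R).
Proof.
move=> N0; apply: norm_cvg0.
suff /fine_cvgP[_] : (`|layer P (- m%:Z) x|%:E @[m --> \oo] --> 0)%E by [].
apply: (squeeze_cvge _ (cvg_cst 0%E) N0); apply: nearW => m.
by rewrite lee_fin normr_ge0 layer_le_Lnorm.
Qed.

(** The bound of [poisson_kernel_le] at level [- m] tends to 0, because [q > 1] when [n > 0]. *)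
Lemma kernel_decay : (0 < n)%N ->
  ('N[mu]_+oo [EFin \o layer K (- m%:Z)] @[m --> \oo] --> 0)%E.
Proof.
move=> n0; pose C : R := kernel_const p n s.
have C0 : 0 <= C by rewrite ltW // kernel_const_gt0.
have bound0 : ((C * (q^-1) ^+ m)%:E @[m --> \oo] --> 0)%E.
  apply: cvg_EFin; first exact: nearW.
  rewrite -(mulr0 C); apply: cvgMr; apply: cvg_expr.
  rewrite ger0_norm ?invr_ge0 ?(ltW q_gt0) // invf_lt1 // exprn_egt1 -?lt0n //.
  by rewrite ltr1n prime_gt1.
apply: (squeeze_cvge _ (cvg_cst 0%E) bound0); apply: nearW => m.
rewrite Lnorm_ge0 /= unlock; case: ifPn => _; last first.
  by rewrite lee_fin mulr_ge0 // exprn_ge0 // invr_ge0 ltW.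
apply/ess_supP; apply: nearW => y /=.
rewrite lee_fin ger0_norm // layer_kernel_vertex //.
by apply: le_trans (poisson_kernel_le _ _ _) _; rewrite // -exprz_inv.
Qed.

Lemma kernel_poisson_problem : (0 < n)%N -> poisson_problem s mu K.
Proof.
move=> n0; split.
- exact: integrable_kernel.
- exact: harmK.
- exact: kernel_weakstar.
- exact: integral_kernel.
- exact: kernel_decay.
Qed.

(** Tested against the indicator of the cell, the weak-* limit must agree with the limit given by
    [cell_average_cvg]; solving this equality for [layer Q k x] yields the recursion. *)
Lemma poisson_problem_recursion Q :
  poisson_problem s mu Q -> kernel_recursion s Q.
Proof.
move=> [_ harmQ initQ _ _] k x.
have /initQ := C0_coset R k x.
have mC := measurable_coset k x.
rewrite integral_indic // setIT.
rewrite -[X in _ --> X]/((\1_(coset k x) (0 : Qpn))%:E : \bar R).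
have -> : (fun m : nat => \int[mu]_y (layer Q m y * \1_(coset k x) y)%:E)%E =
    (fun m : nat => \int[mu]_(y in coset k x) (layer Q m y)%:E)%E.
  apply/funext => m; rewrite [RHS]integral_mkcond; apply: eq_integral => y _.
  by rewrite patchE indicE; case: ifPn => _; rewrite ?mulr1 ?mulr0.
rewrite -(cvg_shiftn `|k|%N) => cvgQ.
(* The weak-* sequence starts at level 0 and the averages at level [k]; both are shifted so that the
   level [i + |k|] equals [k + (i + j)]. *)
have [j jE] : exists j : nat, j%:Z = `|k|%N%:Z - k.
  by exists `|(`|k|%N%:Z - k)%R|%N; lia.
have avgQ : (q ^ (- k) * cell_average Q (i + j)%N k x)%:E @[i --> \oo] -->
    (q ^ (- k) * ((1 - r)^-1 * (layer Q k x - r * layer Q (k - 1) x)))%:E.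
  apply: cvg_EFin; first exact: nearW.
  apply: cvgMr.
  by have := @cell_average_cvg Q harmQ k x; rewrite -(cvg_shiftn j).
have {}cvgQ : (q ^ (- k) * cell_average Q (i + j)%N k x)%:E @[i --> \oo] -->
    (\1_(coset k x) (0 : Qpn))%:E.
  apply: cvg_trans cvgQ; apply: near_eq_cvg; apply: nearW => i /=.
  have -> : (i + `|k|)%N = k + (i + j)%N%:Z :> int by lia.
  by rewrite integral_coset.
have lim := cvg_unique (@ereal_hausdorff R) avgQ cvgQ.
rewrite -(EFin_inj (lim _)).
rewrite -invr_expz; move: (q ^ k) (expfz_neq0 k q_neq0) => qk qk0.
by field; apply/andP.
Qed.

Lemma poisson_problem_unique Q : (0 < n)%N -> poisson_problem s mu Q -> Q = K.
Proof.
move=> n0 pQ; have pK := kernel_poisson_problem n0.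
apply: (kernel_recursion_unique s_gt0).
- exact: poisson_problem_recursion.
- exact: poisson_problem_recursion.
- by move=> x; apply: decay_pointwise; exact: decay pQ.
- by move=> x; apply: decay_pointwise; exact: decay pK.
Qed.

End PoissonProblem.

Theorem theorem4p6 (R : realType) (p n : nat) (p_pr : prime p) (s : R)
    (mu : {measure set (padic_space p_pr n) -> \bar R}) :
  (1 <= n)%N -> 0 < s -> haar_measure mu ->
  exists P : vertex p_pr n -> R,
    (forall k y, layer P k y = poisson_kernel s k y) /\
    (forall Q : vertex p_pr n -> R, poisson_problem s mu Q <-> Q = P).
Proof.
move=> n1 s0 haar_mu; exists (kernel_vertex s); split.
  exact: layer_kernel_vertex.
move=> Q; split=> [|->]; first exact: poisson_problem_unique.
exact: kernel_poisson_problem.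
Qed.
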